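(* Let $1\le k<N$, let $\sigma_{k+1}$ be the $(k+1)$-th largest singular value of $\hat A$, and let $d_{\min}=\min_{x\in\mathcal X}d_x$. Let $f^*:\mathcal{X}\to\mathbb{R}^k$ be any minimizer of $\mathcal{L}_{\text{ACA-PC}}$ over all functions $\mathcal X\to\mathbb{R}^k$. Then for all $x_1,x_2\in\mathcal X$, $$d_{\text{post}}^2(x_1,x_2)-\frac{2\sigma_{k+1}^2}{d_{\min}}\big(1-\delta_{x_1x_2}\big)\;\le\;\|f^*(x_1)-f^*(x_2)\|_2^2\;\le\;d_{\text{post}}^2(x_1,x_2),$$ where $\delta_{x_1x_2}=1$ if $x_1=x_2$ and $0$ otherwise, and $$d_{\text{post}}^2(x_1,x_2)=\sum_{\bar x\in\bar{\mathcal X}}\big(p_{\mathcal A}(\bar x\mid x_1)-p_{\mathcal A}(\bar x\mid x_2)\big)^2,\qquad p_{\mathcal A}(\bar x\mid x)=\frac{p(x\mid\bar x)p(\bar x)}{p_{\mathcal A}(x)}.$$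
   Context: Setting: $\bar{\mathcal{X}}$ is a finite set of ''natural data'' with $|\bar{\mathcal X}|=N$, equipped with the uniform distribution $p(\bar x)=1/N$. $\mathcal{X}$ is a finite set of ''augmented data'' with $|\mathcal X|=L>N$. For each $\bar x\in\bar{\mathcal X}$, $p(\cdot\mid\bar x)$ is a probability distribution on $\mathcal X$ (the augmentation distribution). Let $A\in\mathbb{R}^{N\times L}$ with $A_{\bar x,x}=p(x\mid\bar x)$. For $x\in\mathcal X$ let $d_x=\sum_{\bar x\in\bar{\mathcal X}}p(x\mid\bar x)$, assumed $>0$ for all $x$, and $D=\operatorname{diag}(d_x)_{x\in\mathcal X}$. The normalized augmentation feature matrix is $\hat A=AD^{-1/2}\in\mathbb{R}^{N\times L}$. The marginal distribution of augmented data is $p_{\mathcal A}(x)=\sum_{\bar x}p(x\mid\bar x)p(\bar x)=d_x/N$. For $f:\mathcal X\to\mathbb{R}^k$, $$\mathcal{L}_{\text{ACA-PC}}(f)=-2\,\mathbb{E}_{\bar x\sim p(\bar x),\,x_i\sim p(\cdot\mid\bar x),\,x_j\sim p(\cdot\mid\bar x)}\big[f(x_i)^\top f(x_j)\big]+N\,\mathbb{E}_{x_1\sim p_{\mathcal A},\,x_2\sim p_{\mathcal A}}\Big[\big(f(x_1)^\top f(x_2)\big)^2\Big],$$ with $x_i,x_j$ independent given $\bar x$ and $x_1,x_2$ independent. (Minimizing over all functions corresponds to the paper's assumption that the encoder $f_\theta$ is universal.) *)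

(* Defs.v *)
From HB Require Import structures.
From mathcomp Require Import all_boot all_order all_algebra.
From mathcomp Require Import reals.
Set Implicit Arguments. Unset Strict Implicit. Unset Printing Implicit Defensive.
Import Order.TTheory GRing.Theory Num.Theory.
Local Open Scope ring_scope.

(* Natural data: 'I_N (uniform), augmented data: 'I_L.
   A : 'M_(N, L) with A xbar x = p(x | xbar). *)
Section Defs.
Variable R : realType.
Variables N L k : nat.

Definition dcol (A : 'M[R]_(N, L)) (x : 'I_L) : R := \sum_(i < N) A i x.

(* minimum of d over X (x0 is any element, used as neutral start) *)
Definition dmin (A : 'M[R]_(N, L)) (x0 : 'I_L) : R :=
  \big[Num.min/dcol A x0]_(x < L) dcol A x.

Definition Ahat (A : 'M[R]_(N, L)) : 'M[R]_(N, L) :=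
  \matrix_(i, x) (A i x / Num.sqrt (dcol A x)).

(* s is the list of singular values of M (N <= L), in nonincreasing order,
   with multiplicity: the squares of s are the eigenvalues of M M^T. *)
Definition singular_values (M : 'M[R]_(N, L)) (s : seq R) : Prop :=
  [/\ size s = N, all (fun a => 0 <= a) s, sorted (fun a b => b <= a) s &
      char_poly (M *m M^T) = \prod_(a <- s) ('X - (a ^+ 2)%:P)].

Definition dotv (u v : 'rV[R]_k) : R := \sum_(j < k) u 0 j * v 0 j.

Definition pA (A : 'M[R]_(N, L)) (x : 'I_L) : R := dcol A x / N%:R.

Definition loss_ACA_PC (A : 'M[R]_(N, L)) (f : 'I_L -> 'rV[R]_k) : R :=
  - 2 * (\sum_(i < N) N%:R^-1 *
           \sum_(xi < L) \sum_(xj < L) A i xi * A i xj * dotv (f xi) (f xj))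
  + N%:R * (\sum_(x1 < L) \sum_(x2 < L) pA A x1 * pA A x2 * (dotv (f x1) (f x2)) ^+ 2).

Definition post (A : 'M[R]_(N, L)) (i : 'I_N) (x : 'I_L) : R :=
  A i x * N%:R^-1 / pA A x.

Definition dpost2 (A : 'M[R]_(N, L)) (x1 x2 : 'I_L) : R :=
  \sum_(i < N) (post A i x1 - post A i x2) ^+ 2.

Definition sqnorm (u : 'rV[R]_k) : R := dotv u u.
End Defs.

(* Main.v *)
Require Import Defs.
From HB Require Import structures.
From mathcomp Require Import all_boot all_order all_algebra.
From mathcomp Require Import reals complex spectral ring lra.
Import Order.TTheory GRing.Theory Num.Theory.
Local Open Scope ring_scope.
Set Implicit Arguments. Unset Strict Implicit. Unset Printing Implicit Defensive.

(* With F the matrix of rows sqrt(d_x) f(x) and M = Ahat^T Ahat, the loss is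
   (|M - F F^T|^2 - |M|^2) / N, so F F^T is a best Frobenius approximation of M among
   positive semidefinite matrices of rank at most k. For
   v = e_x1 / sqrt(d_x1) - e_x2 / sqrt(d_x2), the form of M at v is d_post^2, that of
   F F^T is |f(x1) - f(x2)|^2, and |v|^2 = 1 / d_x1 + 1 / d_x2 if x1 <> x2. It remains
   to show 0 <= M - F F^T <= sigma_(k+1)^2. First-order optimality gives
   (M - F F^T) F = 0, so writing v = F w + u with u orthogonal to the columns of F,
   the form of M - F F^T at v is that of M at u, which is nonnegative. Exchanging a
   direction of F for a multiple of u shows that M is at least as large on the range
   of F as it is at u, so Courant-Fischer bounds the form of M at u by
   sigma_(k+1)^2 |u|^2. *)

(** * The Courant-Fischer bound *)

Section CourantFischer.
Local Open Scope sesquilinear_scope.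

Lemma conj_real_mx (R : rcfType) m n (A : 'M[R]_(m, n)) :
  (map_mx (real_complex R) A) ^t* = map_mx (real_complex R) A^T.
Proof. by apply/matrixP=> i j; rewrite !mxE; apply: conjc_real. Qed.

(** For [z = a + i b] the cross terms cancel by symmetry of [X], leaving the sum of the real forms
    at [a] and [b], which are not both zero. This transfers positivity to the complex vectors
    produced by diagonalizing over [R[i]]. *)
Lemma posdef_complexify (R : rcfType) n (X : 'M[R]_n) :
  X^T = X ->
  (forall z : 'rV[R]_n, z != 0 -> 0 < (z *m X *m z^T) 0 0) ->
  forall z : 'rV[R[i]]_n, z != 0 ->
    0 < (z *m map_mx (real_complex R) X *m z ^t*) 0 0.
Proof.
move=> symX Xpos z z0.
pose a : 'rV[R]_n := map_mx (@complex.Re R) z.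
pose b : 'rV[R]_n := map_mx (@complex.Im R) z.
have Xge (c : 'rV[R]_n) : 0 <= (c *m X *m c^T) 0 0.
  by have [->|/Xpos/ltW//] := eqVneq c 0; rewrite !mul0mx mxE.
have zE : z = map_mx (real_complex R) a + 'i%C *: map_mx (real_complex R) b.
  by apply/matrixP=> i j; rewrite !mxE [LHS]complexE.
have zC : z ^t* = map_mx (real_complex R) a^T - 'i%C *: map_mx (real_complex R) b^T.
  apply/matrixP=> i j; rewrite !mxE; case: (z j i) => x y.
  by apply/eqP; rewrite eq_complex /=; apply/andP; split; apply/eqP; ring.
have ab0 : a *m X *m b^T = b *m X *m a^T.
  transitivity (a *m X *m b^T)^T; first by apply/matrixP=> i j; rewrite !ord1 [RHS]mxE.
  by rewrite !trmx_mul trmxK symX mulmxA.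
have -> : z *m map_mx (real_complex R) X *m z ^t* =
    map_mx (real_complex R) (a *m X *m a^T + b *m X *m b^T).
  rewrite zC {1}zE !mulmxDl !mulmxBr -!scalemxAl -!scalemxAr -!map_mxM.
  rewrite ab0 scalerA map_mxD -expr2 sqr_i scaleN1r opprK.
  by rewrite addrA subrK.
rewrite mxE ltcR mxE.
have [a0|a0] := eqVneq a 0; last by rewrite ltr_wpDr ?Xge ?Xpos.
have b0 : b != 0.
  by apply: contraNneq z0 => b0; rewrite zE a0 b0 !map_mx0 scaler0 addr0.
by rewrite ltr_wpDl ?Xge ?Xpos.
Qed.

Lemma char_poly_similar (F : fieldType) n (P A : 'M[F]_n) :
  P \in unitmx -> char_poly (invmx P *m A *m P) = char_poly A.
Proof.
move=> Pu; rewrite /char_poly.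
have -> : char_poly_mx (invmx P *m A *m P) =
    map_mx polyC (invmx P) *m char_poly_mx A *m map_mx polyC P.
  rewrite /char_poly_mx mulmxBr mulmxBl -!map_mxM; congr (_ - _).
  by rewrite mul_mx_scalar -scalemxAl -map_mxM mulVmx // map_mx1 scalemx1.
rewrite !det_mulmx mulrC mulrA -det_mulmx -map_mxM mulmxV //.
by rewrite map_mx1 det1 mul1r.
Qed.

(** Diagonalization takes place over [R[i]]; unique factorization of the characteristic polynomial
    identifies the complex spectrum with the real list [t], so real parts lose nothing. *)
Lemma symmetric_spectral (R : rcfType) n (C : 'M[R]_n) (t : seq R) :
  C^T = C -> char_poly C = \prod_(a <- t) ('X - a%:P) ->
  exists (P : 'M[R[i]]_n) (d : 'I_n -> R),
    [/\ P \is unitarymx, perm_eq [seq d i | i : 'I_n] t &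
     map_mx (real_complex R) C =
       P ^t* *m diag_mx (\row_i real_complex R (d i)) *m P].
Proof.
move=> symC charC; set C' := map_mx _ C.
have CC : C' ^t* = C' by rewrite conj_real_mx symC.
have /orthomx_spectralP : C' \is normalmx by apply/normalmxP; rewrite CC.
have uP := spectral_unitarymx C'; move: uP (spectral_unit C').
move: (spectralmx C') (spectral_diag C') => P sp uP unP CE.
have /prod_XsubC_eq perm_sp : \prod_(a <- [seq sp 0 i | i : 'I_n]) ('X - a%:P) =
    \prod_(a <- map (real_complex R) t) ('X - a%:P).
  rewrite (_ : \prod_(a <- map _ t) _ = char_poly C').
    rewrite CE char_poly_similar // char_poly_trig ?diag_mx_is_trig //.
    rewrite big_image /=; apply: eq_bigr => i _.
    by rewrite mxE eqxx mulr1n.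
  rewrite -map_char_poly charC rmorph_prod big_map; apply: eq_bigr => a _.
  by rewrite rmorphB /= map_polyX map_polyC.
exists P, (fun i => complex.Re (sp 0 i)); split => //.
  have := perm_map (@complex.Re R) perm_sp.
  by rewrite [X in perm_eq _ X]mapK // -map_comp.
rewrite CE invmx_unitary //; congr (_ *m diag_mx _ *m _).
apply/rowP=> i; rewrite mxE.
have : sp 0 i \in map (real_complex R) t.
  by rewrite -(perm_mem perm_sp) map_f // mem_enum.
by case/mapP => a _ ->.
Qed.

Lemma count_gt_sorted (R : realDomainType) (t : seq R) k :
  sorted >=%R t -> (count (fun a => t`_k < a)%R t <= k)%N.
Proof.
move=> st; rewrite -{2}(cat_take_drop k t) count_cat.
have -> : count (fun a => t`_k < a)%R (drop k t) = 0%N.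
  apply/eqP; rewrite -leqn0 leqNgt -has_count; apply/hasPn => a /(nthP 0) [j].
  rewrite size_drop nth_drop => jlt <-; rewrite -leNgt.
  have ltkj : (k + j < size t)%N by rewrite -ltn_subRL.
  have ge_trans : transitive (fun x y : R => y <= x) by move=> y x z yx /le_trans; apply.
  apply: (sorted_leq_nth ge_trans _ 0 st); rewrite ?inE ?leq_addr //.
  exact: leq_ltn_trans (leq_addr _ _) ltkj.
by rewrite addn0 (leq_trans (count_size _ _)) // size_take_min geq_minl.
Qed.

(** At most [k] eigenvalues exceed [t_k], so among [m > k] parameters some nonzero [z] makes [z W]
    orthogonal to all their eigenvectors, and there the form of [C - t_k] is nonpositive. *)
Lemma courant_fischer_lt (R : rcfType) n (C : 'M[R]_n) (t : seq R) k m
    (W : 'M[R]_(m, n)) :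
  (k < m)%N -> C^T = C -> char_poly C = \prod_(a <- t) ('X - a%:P) -> sorted >=%R t ->
  ~ forall z : 'rV_m, z != 0 ->
      t`_k * ((z *m W) *m (z *m W)^T) 0 0 < ((z *m W) *m C *m (z *m W)^T) 0 0.
Proof.
move=> ltkm symC charC st Wpos.
have [P [d [uP perm_d CE]]] := symmetric_spectral symC charC.
(* Shifting by [t_k] and pulling back along [W] turns the hypothesis into positive definiteness of
   [X]. *)
pose X := W *m (C - (t`_k)%:M) *m W^T.
have symX : X^T = X.
  by rewrite !trmx_mul trmxK linearB /= symC tr_scalar_mx mulmxA.
have Xpos (z : 'rV_m) : z != 0 -> 0 < (z *m X *m z^T) 0 0.
  have -> : z *m X *m z^T =
      z *m W *m C *m (z *m W)^T - t`_k *: (z *m W *m (z *m W)^T).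
    rewrite /X !trmx_mul !(mulmxBl, mulmxBr) !mulmxA mul_mx_scalar.
    by rewrite -!(scalemxAl, scalemxAr).
  by move=> /Wpos; rewrite -subr_gt0 !mxE.
pose I := [set i | t`_k < d i].
have cardI : (#|I| <= k)%N.
  apply: leq_trans (count_gt_sorted k st); rewrite -(permP perm_d).
  rewrite -sum1_card -sum1_count big_image_cond /=.
  by under eq_bigl do rewrite inE.
pose W' := map_mx (real_complex R) W.
(* The eigenbasis coordinates with index in [I]: [K] has more rows than columns, hence a nonzero
   left kernel. *)
pose K : 'M_(_, #|I|) := colsub enum_val (W' *m P ^t*).
have : kermx K != 0.
  rewrite -mxrank_eq0 mxrank_ker subn_eq0 -ltnNge.
  exact: leq_ltn_trans (rank_leq_col _) (leq_ltn_trans cardI ltkm).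
case/rowV0Pn => z /sub_kermxP zK z0.
have := posdef_complexify symX Xpos z0.
pose c := z *m W' *m P ^t*.
have cI i : i \in I -> c 0 i = 0.
  move=> iI; have /rowP/(_ (enum_rank_in iI i)) := zK.
  by rewrite mulmx_colsub mulmxA !mxE enum_rankK_in //; apply.
have -> : z *m map_mx (real_complex R) X *m z ^t* =
    c *m diag_mx (\row_i real_complex R (d i - t`_k)) *m c ^t*.
  have PP : P ^t* *m P = 1%:M.
    by rewrite -invmx_unitary // mulVmx ?unitarymx_unit.
  rewrite /X !map_mxM -conj_real_mx map_mxB map_scalar_mx CE /c.
  rewrite !trmx_mul !map_mxM trmxCK !mulmxA; congr (_ *m _ *m _).
  have -> : diag_mx (\row_i real_complex R (d i - t`_k)) =
      diag_mx (\row_i real_complex R (d i)) - (real_complex R t`_k)%:M.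
    apply/matrixP=> i j; rewrite !mxE; case: eqP => _.
      by rewrite !mulr1n rmorphB.
    by rewrite !mulr0n subr0.
  rewrite !(mulmxBl, mulmxBr) !mulmxA; congr (_ - _).
  by rewrite !mul_mx_scalar -!scalemxAl -(mulmxA (z *m W')) PP mulmx1 //.
suff: (c *m diag_mx (\row_i real_complex R (d i - t`_k)) *m c ^t*) 0 0 <= 0.
  by move=> /le_gtF ->.
clearbody c.
rewrite mxE sumr_le0 // => i _.
rewrite mul_mx_diag !mxE.
have [/cI-> | ] := boolP (i \in I); first by rewrite !mul0r.
rewrite inE -leNgt => le_d.
rewrite mulrAC mulr_ge0_le0 ?mul_conjC_ge0 //.
by rewrite (lecR _ 0) subr_le0.
Qed.

End CourantFischer.

(** * Low-rank approximation in Frobenius norm *)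
Definition frob {R : pzRingType} {m n} (X : 'M[R]_(m, n)) : R := \tr (X *m X^T).

Section Frobenius.
Variable R : rcfType.

Lemma frobE m n (X : 'M[R]_(m, n)) : frob X = \sum_i \sum_j X i j ^+ 2.
Proof. by apply: eq_bigr => i _; rewrite mxE; apply: eq_bigr => j _; rewrite mxE. Qed.

Lemma frob_ge0 m n (X : 'M[R]_(m, n)) : 0 <= frob X.
Proof.
by rewrite frobE !sumr_ge0 // => i _; rewrite sumr_ge0 // => j _; rewrite sqr_ge0.
Qed.

Lemma frob_le0 m n (X : 'M[R]_(m, n)) : frob X <= 0 -> X = 0.
Proof.
move=> X0; have {X0} : frob X = 0 by apply/eqP; rewrite eq_le X0 frob_ge0.
have rge0 i : 0 <= \sum_j X i j ^+ 2 by rewrite sumr_ge0 // => j _; rewrite sqr_ge0.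
rewrite frobE => /psumr_eq0P X0; apply/matrixP => i j; rewrite mxE.
have /psumr_eq0P Xi : \sum_j X i j ^+ 2 = 0 by apply: X0.
by apply/eqP; rewrite -sqrf_eq0 Xi // => l _; rewrite sqr_ge0.
Qed.

Lemma mxtr_trmx m n (X Y : 'M[R]_(m, n)) : \tr (X *m Y^T) = \tr (Y *m X^T).
Proof. by rewrite -mxtrace_tr trmx_mul trmxK. Qed.

Lemma frobD m n (X Y : 'M[R]_(m, n)) :
  frob (X + Y) = frob X + 2 * \tr (X *m Y^T) + frob Y.
Proof.
rewrite /frob [(_ + _)^T]linearD mulmxDl !mulmxDr !linearD /= (mxtr_trmx Y X); ring.
Qed.

Lemma frobB m n (X Y : 'M[R]_(m, n)) :
  frob (X - Y) = frob X - 2 * \tr (X *m Y^T) + frob Y.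
Proof.
by rewrite frobD /frob [(- _)^T]linearN !mulNmx !mulmxN !linearN /= mulrN opprK.
Qed.

Lemma frobZ m n a (X : 'M[R]_(m, n)) : frob (a *: X) = a ^+ 2 * frob X.
Proof. by rewrite /frob [(_ *: _)^T]linearZ -scalemxAl -scalemxAr !linearZ /= mulrA. Qed.

(* Expanding [0 <= frob (mu *: X - Y)] avoids Cauchy-Schwarz. *)
Lemma frob_ratio m n (X Y : 'M[R]_(m, n)) mu : 0 <= mu ->
  mu * frob X <= \tr (X *m Y^T) -> mu * \tr (X *m Y^T) <= frob Y.
Proof.
move=> mu0 le_X; have := frob_ge0 (mu *: X - Y).
rewrite frobB frobZ -scalemxAl linearZ /= => h; nra.
Qed.

(** For small positive [t] a nonzero linear term would dominate and make the quartic negative. *)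
Lemma quartic_ge0_linear_coef (a b c d : R) : 0 <= a ->
  (forall t, 0 <= - 2 * a * t + b * t ^+ 2 + c * t ^+ 3 + d * t ^+ 4) -> a = 0.
Proof.
move=> a0 h; apply/eqP; rewrite eq_le a0 andbT leNgt; apply/negP => apos.
(* With [t = a / K] one has [0 < t <= 1], so the higher terms, divided by [t], are at most
   [t K = a], which is less than [2 a]. *)
pose K := 1 + a + `|b| + `|c| + `|d|.
have [b0 c0 d0] : [/\ 0 <= `|b|, 0 <= `|c| & 0 <= `|d|] by split.
have K0 : 0 < K by rewrite /K; lra.
pose t := a / K; have t0 : 0 < t by rewrite divr_gt0.
have t1 : t <= 1 by rewrite ler_pdivrMr // /K; lra.
have tK : t * K = a by rewrite divfK // gt_eqF.
have bb := ler_norm b; have cc := ler_norm c; have dd := ler_norm d.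
have ct : c * t <= `|c|.
  apply: le_trans (_ : `|c| * t <= _); first by rewrite ler_pM2r.
  by rewrite -[leRHS]mulr1 ler_wpM2l.
have dt : d * t ^+ 2 <= `|d|.
  apply: le_trans (_ : `|d| * t ^+ 2 <= _); first by rewrite ler_pM2r ?exprn_gt0.
  by rewrite -[leRHS]mulr1 ler_wpM2l // exprn_ile1 // ltW.
have := h t; have -> : - 2 * a * t + b * t ^+ 2 + c * t ^+ 3 + d * t ^+ 4 =
    t * (- 2 * a + t * (b + c * t + d * t ^+ 2)) by ring.
rewrite pmulr_rge0 // => h1.
have : t * (b + c * t + d * t ^+ 2) <= t * K.
  by rewrite ler_pM2l // /K; lra.
by rewrite tK; lra.
Qed.

End Frobenius.

(** * Optimality conditions for a best low-rank factorization *)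

Section LowRank.
Variables (R : rcfType) (N L k : nat) (B : 'M[R]_(N, L)) (F : 'M[R]_(L, k)).
Let M := B^T *m B.
Hypothesis Fmin : forall G : 'M[R]_(L, k),
  frob (M - F *m F^T) <= frob (M - G *m G^T).

Let Rs := M - F *m F^T.

Let Msym : M^T = M. Proof. by rewrite trmx_mul trmxK. Qed.

Let Rsym : Rs^T = Rs.
Proof. by rewrite linearB /= Msym trmx_mul trmxK. Qed.

(** Moving [F] to [F + t H] with [H = Rs F], the gradient direction, changes the objective by a
    quartic in [t] with linear coefficient [- 4 |H|^2]; minimality forces [H = 0]. *)
Lemma residual_mul_eq0 : (M - F *m F^T) *m F = 0.
Proof.
rewrite -/Rs; move HE: (Rs *m F) => H; apply: frob_le0.
pose X := H *m F^T + F *m H^T; pose Y := H *m H^T.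
have RX : \tr (Rs *m X^T) = 2 * frob H.
  have RHF : \tr (Rs *m H *m F^T) = frob H.
    by rewrite mxtr_trmx trmx_mul Rsym mulmxA mxtrace_mulC mulmxA HE.
  have -> : X^T = F *m H^T + H *m F^T.
    by rewrite [X^T]linearD /= [(H *m _)^T]trmx_mul [(F *m _)^T]trmx_mul !trmxK.
  by rewrite mulmxDr linearD /= !mulmxA RHF HE -/(frob H) mulr_natl mulr2n.
have := @quartic_ge0_linear_coef R (2 * frob H) (frob X - 2 * \tr (Rs *m Y^T))
  (2 * \tr (X *m Y^T)) (frob Y).
move=> h; suff: 2 * frob H = 0 by lra.
apply: h; first by rewrite mulr_ge0 ?frob_ge0.
move=> t; have := Fmin (F + t *: H).
have -> : M - (F + t *: H) *m (F + t *: H)^T = Rs - (t *: X + t ^+ 2 *: Y).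
  rewrite linearD linearZ /= mulmxDl !mulmxDr -!scalemxAl -!scalemxAr scalerA.
  rewrite /Rs /X /Y -expr2 scalerDr -!addrA -!opprD; congr (_ - _).
  by rewrite !addrA; congr (_ + _); rewrite -!addrA; congr (_ + _); rewrite addrC.
rewrite -/Rs; clearbody X Y Rs; rewrite frobB [(_ + _)^T]linearD /= mulmxDr.
rewrite ![(_ *: _)^T]linearZ /= -!scalemxAr.
rewrite linearD !linearZ /=.
rewrite RX frobD !frobZ linearZ /= -scalemxAl -scalemxAr !linearZ /=; nra.
Qed.

Lemma ortho_decomposition (v : 'rV[R]_L) :
  exists (w : 'rV[R]_k) (u : 'rV[R]_L), v = w *m F^T + u /\ u *m F = 0.
Proof.
(* The normal equations [w F^T F = v F] are solvable even if [F] is rank-deficient, because [F^T F]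
   and [F] have the same row space. *)
have /submxP [w wE] : (v *m F <= F^T *m F)%MS.
  have: F *m cokermx (F^T *m F) = 0.
    apply: frob_le0; rewrite /frob mxtrace_mulC trmx_mul -!mulmxA.
    by rewrite (mulmxA F^T) mulmx_coker mulmx0 linear0.
  by move=> FK; rewrite submxE -mulmxA FK mulmx0.
exists w, (v - w *m F^T); split; first by rewrite addrC subrK.
by rewrite mulmxBl wE mulmxA subrr.
Qed.

Lemma residual_quad (w : 'rV[R]_k) (u : 'rV[R]_L) : u *m F = 0 ->
  \tr ((w *m F^T + u) *m (M - F *m F^T) *m (w *m F^T + u)^T) = frob (u *m B^T).
Proof.
move=> uF; have FR : F^T *m Rs = 0.
  by rewrite -Rsym -trmx_mul residual_mul_eq0 linear0.
have RF : Rs *m F = 0 := residual_mul_eq0.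
have uR : u *m Rs = u *m M by rewrite mulmxBr (mulmxA u F) uF mul0mx subr0.
rewrite -/Rs; clearbody Rs; rewrite mulmxDl -(mulmxA w) FR mulmx0 add0r.
rewrite [(_ + _)^T]linearD /= mulmxDr [(w *m _)^T]trmx_mul trmxK mulmxA.
rewrite -(mulmxA u Rs) RF mulmx0 mul0mx add0r uR /frob /M [(u *m _)^T]trmx_mul.
by rewrite trmxK !mulmxA.
Qed.

(* Replacing the unit direction [w] of the factor [F] by a multiple of [u]
   turns [F F^T] into [F F^T - p p^T + c^2 u^T u], where [p = F w^T]. *)
Lemma swap_energy_le_unit (w : 'rV[R]_k) (u : 'rV[R]_L) :
  u *m F = 0 -> frob u = 1 -> frob w = 1 -> frob (u *m B^T) <= frob (w *m F^T).
Proof.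
move=> uF u1 w1.
set mu := frob (u *m B^T); set tau := frob (w *m F^T).
have mu0 : 0 <= mu := frob_ge0 _; have tau0 : 0 <= tau := frob_ge0 _.
(* The swap changes the objective by [tau^2 - 2 c^2 mu + c^4], which is least at [c^2 = mu], with
   value [tau^2 - mu^2]. *)
pose c := Num.sqrt mu; have cc : c ^+ 2 = mu by rewrite sqr_sqrtr.
have scal (x : 'M[R]_1) a : \tr x = a -> x = a%:M.
  by move=> <-; rewrite trace_mx11 -mx11_scalar.
have ww : w *m w^T = 1%:M by apply: scal.
have uu : u *m u^T = 1%:M by apply: scal.
have [p pE] : exists p, p = F *m w^T by exists (F *m w^T).
have pT : p^T = w *m F^T by rewrite pE trmx_mul trmxK.
have pp : p^T *m p = tau%:M by apply: scal; rewrite pT pE /tau /frob trmx_mul trmxK.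
have up : u *m p = 0 by rewrite pE mulmxA uF mul0mx.
have Fu : F^T *m u^T = 0 by rewrite -trmx_mul uF linear0.
have pu : p^T *m u^T = 0 by rewrite pT -mulmxA Fu mulmx0.
have Rp : Rs *m p = 0 by rewrite pE mulmxA residual_mul_eq0 mul0mx.
pose E := p *m p^T - mu *: (u^T *m u).
(* [Q] is [F] with the direction [w] removed, so the new term in [w] creates no cross terms in the
   product. *)
pose Q := F - p *m w.
have Qw : Q *m w^T = 0 by rewrite mulmxBl -mulmxA ww mulmx1 pE subrr.
have wQ : w *m Q^T = 0 by rewrite -[w]trmxK -trmx_mul Qw linear0.
have QQ : Q *m Q^T = F *m F^T - p *m p^T.
  rewrite {2}/Q [(_ - _)^T]linearB /= trmx_mul mulmxBr mulmxA Qw mul0mx subr0.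
  by rewrite mulmxBl pT mulmxA.
have := Fmin (Q + c *: (u^T *m w)).
have -> : M - (Q + c *: (u^T *m w)) *m (Q + c *: (u^T *m w))^T = Rs + E.
  have -> : (Q + c *: (u^T *m w)) *m (Q + c *: (u^T *m w))^T =
      Q *m Q^T + mu *: (u^T *m u).
    rewrite -cc; clearbody Q.
    rewrite linearD linearZ /= trmx_mul trmxK.
    rewrite mulmxDl !mulmxDr -!scalemxAl -!scalemxAr mulmxA Qw mul0mx scaler0.
    rewrite addr0 -mulmxA wQ mulmx0 scaler0 add0r scalerA expr2.
    by rewrite mulmxA -(mulmxA u^T) ww mulmx1.
  by rewrite QQ /E /Rs !opprD !opprK !addrA.
have uR : Rs *m u^T = M *m u^T by rewrite mulmxBl -(mulmxA F) Fu mulmx0 subr0.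
have trM : \tr (M *m u^T *m u) = mu.
  by rewrite mxtrace_mulC /mu /frob trmx_mul trmxK !mulmxA.
rewrite -/Rs; clearbody Rs; rewrite frobD.
have ET : E^T = E.
  by rewrite /E linearB linearZ /= !trmx_mul !trmxK.
have -> : \tr (Rs *m E^T) = - mu ^+ 2.
  rewrite ET mulmxBr mulmxA Rp mul0mx sub0r -scalemxAr mulmxA uR.
  by rewrite linearN linearZ /= trM expr2.
have -> : frob E = tau ^+ 2 + mu ^+ 2.
  rewrite /frob ET /E mulmxBl !mulmxBr -!scalemxAl -!scalemxAr.
  rewrite !mulmxA -[p *m p^T *m p]mulmxA pp -[p *m p^T *m u^T]mulmxA pu.
  rewrite mulmx0 mul0mx scaler0 subr0.
  rewrite -[u^T *m u *m p]mulmxA up mulmx0 mul0mx scaler0 sub0r opprK.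
  rewrite -[u^T *m u *m u^T]mulmxA uu mulmx1 mul_mx_scalar -scalemxAl.
  rewrite linearD !linearZ /= mxtrace_mulC pp mxtrace_scalar.
  by rewrite [\tr (u^T *m u)]mxtrace_mulC uu mxtrace1 mulr1.
move=> h; suff : mu ^+ 2 <= tau ^+ 2 by rewrite ler_sqr ?nnegrE.
by lra.
Qed.

Lemma swap_energy_le (w : 'rV[R]_k) (u : 'rV[R]_L) :
  u *m F = 0 -> frob (u *m B^T) * frob w <= frob (w *m F^T) * frob u.
Proof.
move=> uF.
have [->|u0] := eqVneq u 0.
  by rewrite mul0mx /frob !(mul0mx, linear0) !(mul0r, mulr0).
have [->|w0] := eqVneq w 0.
  by rewrite mul0mx /frob !(mul0mx, linear0) !(mul0r, mulr0).
have fpos m (x : 'rV[R]_m) : x != 0 -> 0 < frob x.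
  by move=> x0; rewrite ltNge; apply: contra x0 => /frob_le0 ->.
have norm1 m (x : 'rV[R]_m) : x != 0 -> frob ((Num.sqrt (frob x))^-1 *: x) = 1.
  by move=> /fpos x0; rewrite frobZ exprVn sqr_sqrtr ?ltW // mulVf ?gt_eqF.
have := @swap_energy_le_unit _ _ _ (norm1 _ _ u0) (norm1 _ _ w0).
rewrite -!scalemxAl uF scaler0 !frobZ !exprVn !sqr_sqrtr ?frob_ge0 //.
move=> /(_ erefl); rewrite ![_^-1 * _]mulrC ler_pdivrMr ?fpos // mulrAC.
by rewrite ler_pdivlMr ?fpos.
Qed.

(* Otherwise the quadratic form of [M] on the [k + 1]-dimensional space spanned by
   [u] and the columns of [F] would contradict Courant-Fischer. *)
Lemma ortho_energy_le (t : seq R) (u : 'rV[R]_L) :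
  sorted >=%R t -> 0 <= t`_k ->
  char_poly (B *m B^T) = \prod_(a <- t) ('X - a%:P) ->
  u *m F = 0 -> frob (u *m B^T) <= t`_k * frob u.
Proof.
move=> st tk0 charB uF; rewrite leNgt; apply/negP => lt_tk.
have u0 : 0 < frob u.
  rewrite ltNge; apply/negP => /frob_le0 u0; move: lt_tk.
  by rewrite u0 mul0mx /frob !(mul0mx, linear0) mulr0 ltxx.
pose mu := frob (u *m B^T) / frob u.
have lt_mu : t`_k < mu by rewrite ltr_pdivlMr.
have mu0 : 0 < mu by apply: le_lt_trans lt_mu.
have muE : mu * frob u = frob (u *m B^T) by rewrite divfK ?gt_eqF.
have FTM : F^T *m M = F^T *m F *m F^T.
  have : F^T *m Rs = 0 by rewrite -Rsym -trmx_mul residual_mul_eq0 linear0.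
  by rewrite mulmxBr => /eqP; rewrite subr_eq0 => /eqP ->; rewrite mulmxA.
have Fu : F^T *m u^T = 0 by rewrite -trmx_mul uF linear0.
have MtrE (v : 'rV[R]_L) : \tr (v *m (v *m M)^T) = frob (v *m B^T).
  by rewrite /frob /M !trmx_mul !trmxK !mulmxA.
have swapw (w : 'rV[R]_k) : mu * frob w <= frob (w *m F^T).
  by have := swap_energy_le w uF; rewrite -muE mulrAC ler_pM2r.
(* The range of [F] is [M]-invariant and orthogonal to [u], so both sides split into a [w] part and
   a [u] part; the [u] parts agree by the choice of [mu]. *)
have bound (w : 'rV[R]_k) (c : R) (v := w *m F^T + c *: u) :
    mu * frob v <= frob (v *m B^T).
  rewrite -MtrE.
  (* [frob_ratio] for [w] and [w F^T F], whose inner product is [|w F^T|^2]. *)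
  have wS : mu * frob (w *m F^T) <= frob (w *m (F^T *m F)).
    have eS : frob (w *m F^T) = \tr (w *m (w *m (F^T *m F))^T).
      by rewrite /frob !trmx_mul !trmxK !mulmxA.
    rewrite eS; apply: frob_ratio; first exact: ltW.
    by rewrite -eS swapw.
  have wFu : w *m F^T *m u^T = 0 by rewrite -mulmxA Fu mulmx0.
  have -> : frob v = frob (w *m F^T) + c ^+ 2 * frob u.
    by rewrite frobD frobZ linearZ /= -scalemxAr wFu scaler0 linear0 mulr0 addr0.
  have -> : \tr (v *m (v *m M)^T) =
      frob (w *m (F^T *m F)) + c ^+ 2 * frob (u *m B^T).
    have -> : v *m M = w *m (F^T *m F) *m F^T + c *: (u *m M).
      by rewrite mulmxDl -(mulmxA w) FTM -scalemxAl !mulmxA.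
    have -> : (w *m (F^T *m F) *m F^T + c *: (u *m M))^T =
        F *m (w *m (F^T *m F))^T + c *: (u *m M)^T.
      by rewrite linearD linearZ /= [(_ *m F^T)^T]trmx_mul trmxK.
    rewrite /v mulmxDl !mulmxDr -!scalemxAl -!scalemxAr mulmxA.
    have -> : w *m F^T *m (u *m M)^T = 0.
      by rewrite trmx_mul Msym mulmxA -(mulmxA w) FTM -!mulmxA Fu !mulmx0.
    rewrite [u *m (F *m _)]mulmxA uF mul0mx !scaler0 addr0 add0r scalerA -expr2.
    by rewrite linearD linearZ /= MtrE -(mulmxA w).
  by rewrite mulrDr mulrCA muE lerD2r.
pose V := col_mx F^T u.
(* The known spectrum is that of [B B^T], so the space spanned by [u] and the columns of [F] is
   carried over by [B^T]; the form of [B B^T] at [v B^T] is [|v M|^2]. *)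
apply: (@courant_fischer_lt R N (B *m B^T) t k (k + 1) (V *m B^T)) => //.
- by rewrite addn1.
- by rewrite trmx_mul trmxK.
move=> z z0; rewrite -!trace_mx11.
pose w := lsubmx z; pose c := rsubmx z 0 0.
pose v := w *m F^T + c *: u.
have vE : z *m (V *m B^T) = v *m B^T.
  rewrite mulmxA -{1}[z]hsubmxK mul_row_col [rsubmx z]mx11_scalar.
  by rewrite mul_scalar_mx.
rewrite vE -/(frob _).
have -> : \tr (v *m B^T *m (B *m B^T) *m (v *m B^T)^T) = frob (v *m M).
  by rewrite /frob /M !trmx_mul !trmxK !mulmxA.
(* The [k + 1] spanning vectors are independent: pairing with [u] kills [c], then
   [mu |w|^2 <= |w F^T|^2] with [mu > 0] kills [w]. *)
have v0 : 0 < frob v.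
  rewrite ltNge; apply/negP => /frob_le0 v0; move/eqP: z0; apply.
  have c0 : c = 0.
    have : \tr (v *m u^T) = 0 by rewrite v0 mul0mx linear0.
    rewrite mulmxDl -mulmxA Fu mulmx0 add0r -scalemxAl linearZ /= => /eqP.
    by rewrite mulf_eq0 (gt_eqF u0) orbF => /eqP.
  have w0 : w = 0.
    apply: frob_le0; rewrite -(pmulr_rle0 _ mu0) (le_trans (swapw w)) //.
    move: v0; rewrite /v c0 scale0r addr0 => ->.
    by rewrite /frob mul0mx linear0.
  rewrite -[z]hsubmxK [rsubmx z]mx11_scalar -/w -/c w0 c0 raddf0.
  exact: row_mx0.
have le_b := bound w c; rewrite -/v in le_b.
have b0 : 0 < frob (v *m B^T) by apply: lt_le_trans le_b; rewrite mulr_gt0.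
apply: lt_le_trans (_ : mu * frob (v *m B^T) <= _); first by rewrite ltr_pM2r.
by rewrite -MtrE; apply: frob_ratio; [exact: ltW | rewrite MtrE].
Qed.

Lemma residual_ge0 (v : 'rV[R]_L) :
  0 <= \tr (v *m (M - F *m F^T) *m v^T).
Proof.
have [w [u [-> uF]]] := ortho_decomposition v.
by rewrite residual_quad // frob_ge0.
Qed.

Lemma residual_le (t : seq R) (v : 'rV[R]_L) :
  sorted >=%R t -> 0 <= t`_k ->
  char_poly (B *m B^T) = \prod_(a <- t) ('X - a%:P) ->
  \tr (v *m (M - F *m F^T) *m v^T) <= t`_k * frob v.
Proof.
move=> st tk0 charB; have [w [u [-> uF]]] := ortho_decomposition v.
rewrite residual_quad //; apply: le_trans (ortho_energy_le st tk0 charB uF) _.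
(* By Pythagoras [|u|^2 <= |w F^T + u|^2]. *)
rewrite ler_wpM2l // frobD -[w *m F^T *m _]mulmxA -trmx_mul uF linear0 mulmx0.
by rewrite linear0 mulr0 addr0 lerDr frob_ge0.
Qed.

End LowRank.

(** * The loss as an approximation error *)

Section Loss.
Variables (R : realType) (N L k : nat) (A : 'M[R]_(N, L)).
Hypothesis d_gt0 : forall x, 0 < dcol A x.

Let M := (Ahat A)^T *m Ahat A.

Definition scaled_features (f : 'I_L -> 'rV[R]_k) : 'M[R]_(L, k) :=
  \matrix_(x, j) (Num.sqrt (dcol A x) * f x 0 j).

Lemma sqrt_d_neq0 x : Num.sqrt (dcol A x) != 0.
Proof. by rewrite sqrtr_eq0 -ltNge. Qed.

Lemma gramE f x y : (scaled_features f *m (scaled_features f)^T) x y =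
  Num.sqrt (dcol A x) * Num.sqrt (dcol A y) * dotv (f x) (f y).
Proof. by rewrite mxE mulr_sumr; apply: eq_bigr => j _; rewrite !mxE; ring. Qed.

(** Through this, minimality over all encoders becomes minimality over all factor matrices. *)
Lemma scaled_features_surj (G : 'M[R]_(L, k)) : exists g, scaled_features g = G.
Proof.
exists (fun x => (Num.sqrt (dcol A x))^-1 *: row x G).
by apply/matrixP => x j; rewrite !mxE mulVKf // sqrt_d_neq0.
Qed.

(** Expanding the square, the inner product of [M] and [F F^T] is the positive-pair term and
    [|F F^T|^2] the term over independent pairs, the weights [d_x] being absorbed by the square
    roots. *)
Lemma loss_frobE f : (0 < N)%N ->
  loss_ACA_PC A f = N%:R^-1 *
    (frob (M - scaled_features f *m (scaled_features f)^T) - frob M).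
Proof.
move=> N0; set G := _ *m _.
have NR : N%:R != 0 :> R by rewrite pnatr_eq0 -lt0n.
rewrite frobB addrAC [frob M + _]addrC addrK mulrDr; congr (_ + _).
  rewrite -mulr_sumr mulrCA -mulNr; congr (_ * (_ * _)).
  rewrite exchange_big /=; apply: eq_bigr => x _.
  rewrite exchange_big mxE /=; apply: eq_bigr => y _.
  rewrite [G^T _ _]mxE gramE [M _ _]mxE mulr_suml; apply: eq_bigr => i _; rewrite !mxE.
  by field; rewrite !sqrt_d_neq0.
rewrite frobE !mulr_sumr; apply: eq_bigr => x _.
rewrite !mulr_sumr; apply: eq_bigr => y _.
rewrite gramE !exprMn !sqr_sqrtr ?ltW // /pA.
by field.
Qed.

Definition scaled_diff (x1 x2 : 'I_L) : 'rV[R]_L :=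
  (Num.sqrt (dcol A x1))^-1 *: delta_mx 0 x1 -
  (Num.sqrt (dcol A x2))^-1 *: delta_mx 0 x2.

Lemma scaled_diff_mulmxE n (X : 'M[R]_(L, n)) x1 x2 j :
  (scaled_diff x1 x2 *m X) 0 j =
  X x1 j / Num.sqrt (dcol A x1) - X x2 j / Num.sqrt (dcol A x2).
Proof. by rewrite mulmxBl -!scalemxAl -!rowE !mxE ![_^-1 * _]mulrC. Qed.

Lemma frob_scaled_diff_features f x1 x2 :
  frob (scaled_diff x1 x2 *m scaled_features f) = sqnorm (f x1 - f x2).
Proof.
rewrite frobE big_ord1; apply: eq_bigr => j _.
rewrite scaled_diff_mulmxE !mxE expr2; congr (_ * _);
  by field; rewrite !sqrt_d_neq0.
Qed.

Lemma frob_scaled_diff_Ahat x1 x2 : (0 < N)%N ->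
  frob (scaled_diff x1 x2 *m (Ahat A)^T) = dpost2 A x1 x2.
Proof.
move=> N0; have NR : N%:R != 0 :> R by rewrite pnatr_eq0 -lt0n.
rewrite frobE big_ord1; apply: eq_bigr => i _; congr (_ ^+ 2).
(* The uniform prior [1 / N] cancels in Bayes' rule, so the posterior is [A i x / d_x]. *)
have sq x : A i x / Num.sqrt (dcol A x) / Num.sqrt (dcol A x) = post A i x.
  rewrite -mulrA -invfM -expr2 sqr_sqrtr ?ltW // /post /pA.
  by field; rewrite NR gt_eqF.
by rewrite scaled_diff_mulmxE !mxE !sq.
Qed.

Lemma dmin_gt0 x0 : 0 < dmin A x0.
Proof. by apply/bigmin_gtP. Qed.

Lemma frob_scaled_diff_le x1 x2 :
  frob (scaled_diff x1 x2) <= 2 / dmin A x1 * (1 - (x1 == x2)%:R).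
Proof.
have [->|nx] := eqVneq x1 x2.
  by rewrite /scaled_diff subrr subrr mulr0 /frob mul0mx linear0.
rewrite subr0 mulr1 frobB !frobZ !exprVn !sqr_sqrtr ?(ltW (d_gt0 _)) //.
have dd (x y : 'I_L) : (delta_mx 0 x : 'rV[R]_L) *m (delta_mx 0 y)^T = (x == y)%:R%:M.
  apply/matrixP => i j; rewrite trmx_delta mul_delta_mx_cond [RHS]mxE !ord1 eqxx mulr1n.
  by case: (x == y); rewrite ?mulr1n ?mulr0n !mxE ?eqxx.
rewrite linearZ /= -scalemxAl -scalemxAr dd (negPf nx).
rewrite /frob !dd !eqxx !mxtrace1 raddf0 !scaler0 linear0 mulr0 subr0 !mulr1.
have dle x : (dcol A x)^-1 <= (dmin A x1)^-1.
  by rewrite lef_pV2 ?posrE ?dmin_gt0 //; apply: bigmin_le_cond.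
by have := dle x1; have := dle x2; lra.
Qed.

End Loss.

(** * The two-sided bound on feature distances *)

Theorem theorem4p2 (R : realType) (N L k : nat) (A : 'M[R]_(N, L))
  (s : seq R) (fstar : 'I_L -> 'rV[R]_k) :
  (N < L)%N ->
  (forall i x, 0 <= A i x) ->
  (forall i : 'I_N, \sum_(x < L) A i x = 1) ->
  (forall x, 0 < dcol A x) ->
  (1 <= k)%N -> (k < N)%N ->
  singular_values (Ahat A) s ->
  (forall g : 'I_L -> 'rV[R]_k, loss_ACA_PC A fstar <= loss_ACA_PC A g) ->
  forall x1 x2 : 'I_L,
    dpost2 A x1 x2 - 2 * (s`_k) ^+ 2 / dmin A x1 * (1 - (x1 == x2)%:R)
      <= sqnorm (fstar x1 - fstar x2)
    /\ sqnorm (fstar x1 - fstar x2) <= dpost2 A x1 x2.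
Proof.
move=> _ _ _ d_gt0 _ ltkN [size_s s_ge0 s_sorted charA] fmin x1 x2.
have N0 : (0 < N)%N by apply: leq_ltn_trans ltkN.
pose F := scaled_features A fstar; pose M := (Ahat A)^T *m Ahat A.
have Fmin (G : 'M[R]_(L, k)) : frob (M - F *m F^T) <= frob (M - G *m G^T).
  have [g <-] := scaled_features_surj d_gt0 G; have := fmin g.
  by rewrite !loss_frobE // ler_pM2l ?invr_gt0 ?ltr0n // lerD2r.
pose t := [seq a ^+ 2 | a <- s].
have t_sorted : sorted >=%R t.
  rewrite sorted_map; apply: (sub_in_sorted _ s_ge0 s_sorted) => a b a0 b0 /= ba.
  by rewrite lerXn2r ?nnegrE.
(* Indices start at 0, so entry [k] belongs to the [(k+1)]-th singular value; [k < N] keeps it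
   within the list. *)
have tkE : t`_k = s`_k ^+ 2 by rewrite (nth_map 0) // size_s.
have charT : char_poly (Ahat A *m (Ahat A)^T) = \prod_(a <- t) ('X - a%:P).
  by rewrite big_map.
pose v := scaled_diff A x1 x2.
have vE : \tr (v *m (M - F *m F^T) *m v^T) =
    dpost2 A x1 x2 - sqnorm (fstar x1 - fstar x2).
  rewrite -(frob_scaled_diff_Ahat d_gt0) // -(frob_scaled_diff_features d_gt0).
  by rewrite mulmxBr mulmxBl linearB /= /frob !trmx_mul !trmxK !mulmxA.
have := residual_ge0 Fmin v; rewrite vE => lo.
have := residual_le Fmin v t_sorted _ charT.
rewrite vE tkE sqr_ge0 => /(_ isT) hi.
split; last by rewrite -subr_ge0.
rewrite lerBlDr addrC -lerBlDr; apply: le_trans hi _.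
have -> : 2 * s`_k ^+ 2 / dmin A x1 * (1 - (x1 == x2)%:R) =
    s`_k ^+ 2 * (2 / dmin A x1 * (1 - (x1 == x2)%:R)) by ring.
by rewrite ler_wpM2l ?sqr_ge0 // frob_scaled_diff_le.
Qed.
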